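(* Let $F$ be a non-Abelian free group and let $N_1,N_2$ be normal subgroups of $F$, given as the normal closures $N_1=R_1^F$, $N_2=R_2^F$ of sets $R_1,R_2$ of words in a basis of $F$ and its inverses. If the groups $F/[F,N_1]$, $F/[F,N_2]$, $H_2(N_1N_2/N_1)$ and $H_2(N_1N_2/N_2)$ are torsion-free, then the group $F/[N_1,N_2]$ is torsion-free.
   Context: For subgroups $M,N$ of $F$, $[M,N]$ denotes the subgroup generated by all commutators $[g,h]=g^{-1}h^{-1}gh$ with $g\in M$, $h\in N$. $R^F$ denotes the normal closure of a subset $R\subseteq F$ in $F$. $H_2(U)$ is the second homology group of a group $U$ with trivial integer coefficients. *)

(* Defs.v *)
From HB Require Import structures.
From mathcomp Require Import all_boot all_algebra.
From mathcomp Require Import ring boolp classical_sets.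
From mathcomp.multinomials Require Import freeg.

Set Implicit Arguments.
Unset Strict Implicit.
Unset Printing Implicit Defensive.

Import GRing.Theory.

Local Open Scope classical_set_scope.
Local Open Scope quotient_scope.
Local Open Scope group_scope.

Definition torsion_free (G : groupType) : Prop :=
  forall (x : G) (n : nat), (0 < n)%N -> x ^+ n = 1 -> x = 1.

Definition torsion_free_zmod (A : zmodType) : Prop :=
  (forall (x : A) (n : nat), (0 < n)%N -> x *+ n = 0 -> x = 0)%R.

Definition abelian_group (G : groupType) : Prop := forall x y : G, commute x y.

(* The universal property of the free group on [X]; the values of [f] outside
   [X] are irrelevant. *)
Definition free_basis (G : groupType) (X : set G) : Prop :=
  forall (H : groupType) (f : G -> H),
    (exists2 phi : G -> H, {morph phi : x y / x * y} & {in X, phi =1 f}) /\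
    (forall phi psi : G -> H,
       {morph phi : x y / x * y} -> {morph psi : x y / x * y} ->
       {in X, phi =1 psi} -> phi =1 psi).

(* A word in [X] and its inverses is a finite sequence of letters; the letter
   [(x, true)] stands for [x] and [(x, false)] for [x^-1]. *)
Definition word (G : groupType) (X : set G) : Type := seq (X * bool).

Definition word_eval (G : groupType) (X : set G) (w : word X) : G :=
  \prod_(l <- w) (if l.2 then val l.1 else (val l.1)^-1).

HB.mixin Record isConjClosed (G : groupType) (S : {pred G}) := {
  conj_closedP : forall x g : G, x \in S -> x ^ g \in S
}.

#[short(type="normalClosed")]
HB.structure Definition NormalClosed G :=
  {S of isConjClosed G S & GroupClosed G S}.

Definition gen (G : groupType) (A : set G) : {pred G} := fun x =>
  `[< forall H : {pred G}, group_closed H -> A `<=` [set` H] -> x \in H >].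

Definition nclosure (G : groupType) (R : set G) : {pred G} :=
  gen [set x | exists2 r, R r & exists g, x = r ^ g].

Definition commsub (G : groupType) (M N : {pred G}) : {pred G} :=
  gen [set x | exists g h, [/\ g \in M, h \in N & x = [~ g, h]]].

Definition prodset (G : groupType) (M N : {pred G}) : {pred G} := fun x =>
  `[< exists g h, [/\ g \in M, h \in N & x = g * h] >].

Definition full (G : groupType) : {pred G} := fun=> true.
Arguments full : clear implicits.

Section FullInstances.
Variable G : groupType.
HB.instance Definition _ := isMulClosed.Build G (full G) (fun _ _ _ _ => isT).
HB.instance Definition _ := isMul1Closed.Build G (full G) isT.
HB.instance Definition _ := isInvClosed.Build G (full G) (fun _ _ => isT).
HB.instance Definition _ := isConjClosed.Build G (full G) (fun _ _ _ => isT).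
End FullInstances.

Section GenTheory.
Variables (G : groupType) (A : set G).

Lemma gen_mulg_closed : mulg_closed (gen A).
Proof.
move=> x y /asboolP Hx /asboolP Hy; apply/asboolP => H gH AH.
by apply: group_closedM => //; [apply: Hx | apply: Hy].
Qed.

Lemma gen_one : 1 \in gen A.
Proof. by apply/asboolP => H []. Qed.

Lemma gen_invg_closed : invg_closed (gen A).
Proof.
move=> x /asboolP Hx; apply/asboolP => H gH AH.
by apply: group_closedV => //; apply: Hx.
Qed.

Lemma gen_conj_closed : (forall a g, A a -> A (a ^ g)) ->
  forall x g, x \in gen A -> x ^ g \in gen A.
Proof.
move=> AJ x g /asboolP Hx; apply/asboolP => H [H1 HF] AH.
suff: x \in [pred z | z ^ g \in H] by [].
apply: Hx => [|a Aa]; last by apply: AH; apply: AJ.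
split=> [|u v uH vH]; rewrite inE ?conj1g // conjMg conjVg; exact: HF.
Qed.

End GenTheory.

Section NclosureInstances.
Variables (G : groupType) (R : set G).

Lemma nclosure_conj_closed x g : x \in nclosure R -> x ^ g \in nclosure R.
Proof.
apply: gen_conj_closed => _ {}g [r Rr [h ->]].
by exists r => //; exists (h * g); rewrite conjgM.
Qed.

HB.instance Definition _ :=
  isMulClosed.Build G (nclosure R) (@gen_mulg_closed G _).
HB.instance Definition _ := isMul1Closed.Build G (nclosure R) (@gen_one G _).
HB.instance Definition _ :=
  isInvClosed.Build G (nclosure R) (@gen_invg_closed G _).
HB.instance Definition _ :=
  isConjClosed.Build G (nclosure R) nclosure_conj_closed.
End NclosureInstances.

Section CommsubInstances.
Variables (G : groupType) (M N : normalClosed G).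

Lemma commsub_conj_closed x g : x \in commsub M N -> x ^ g \in commsub M N.
Proof.
apply: gen_conj_closed => _ {}g [a [b [aM bN ->]]].
exists (a ^ g), (b ^ g); split; last exact: conjRg.
- exact: conj_closedP.
- exact: conj_closedP.
Qed.

HB.instance Definition _ :=
  isMulClosed.Build G (commsub M N) (@gen_mulg_closed G _).
HB.instance Definition _ := isMul1Closed.Build G (commsub M N) (@gen_one G _).
HB.instance Definition _ :=
  isInvClosed.Build G (commsub M N) (@gen_invg_closed G _).
HB.instance Definition _ :=
  isConjClosed.Build G (commsub M N) commsub_conj_closed.
End CommsubInstances.

Section ProdInstances.
Variables (G : groupType) (M N : normalClosed G).

Lemma prodset_mulg_closed : mulg_closed (prodset M N).
Proof.
move=> _ _ /asboolP[a [b [aM bN ->]]] /asboolP[c [d [cM dN ->]]].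
apply/asboolP; exists (a * c), (b ^ c * d); split; last first.
- by rewrite conjgE !mulgA mulgK.
- by rewrite gpredM // conj_closedP.
- by rewrite gpredM.
Qed.

Lemma prodset_one : 1 \in prodset M N.
Proof. by apply/asboolP; exists 1, 1; rewrite !gpred1 mulg1. Qed.

Lemma prodset_invg_closed : invg_closed (prodset M N).
Proof.
move=> _ /asboolP[a [b [aM bN ->]]].
apply/asboolP; exists a^-1, (b^-1 ^ a^-1); split; last first.
- by rewrite conjgE invgM invgK !mulgA mulVg mul1g.
- by rewrite conj_closedP // gpredV.
- by rewrite gpredV.
Qed.

Lemma prodset_conj_closed x g : x \in prodset M N -> x ^ g \in prodset M N.
Proof.
move=> /asboolP[a [b [aM bN ->]]]; apply/asboolP; exists (a ^ g), (b ^ g).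
by rewrite conjMg !conj_closedP.
Qed.

HB.instance Definition _ :=
  isMulClosed.Build G (prodset M N) prodset_mulg_closed.
HB.instance Definition _ := isMul1Closed.Build G (prodset M N) prodset_one.
HB.instance Definition _ :=
  isInvClosed.Build G (prodset M N) prodset_invg_closed.
HB.instance Definition _ :=
  isConjClosed.Build G (prodset M N) prodset_conj_closed.
End ProdInstances.

Section SubgroupType.
Variables (G : groupType) (H : groupClosed G).

Record subgroup := Subgroup { subgroup_val : G; _ : subgroup_val \in H }.

HB.instance Definition _ := [isSub for subgroup_val].
HB.instance Definition _ := [Choice of subgroup by <:].

Lemma subgroup_group_closed : group_closed H.
Proof. by split; [exact: gpred1 | exact: gpredF]. Qed.

HB.instance Definition _ :=
  SubChoice_isSubGroup.Build G _ subgroup subgroup_group_closed.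
End SubgroupType.

(* The trace of [N] on [H]; when [N] is contained in [H] this is [N] itself,
   seen inside the group [subgroup H]. *)
Definition in_subgroup (G : groupType) (H : groupClosed G) (N : {pred G}) :
  {pred subgroup H} := fun x => val x \in N.
Arguments in_subgroup {G} H N.

Section InSubgroupInstances.
Variables (G : groupType) (H : groupClosed G) (N : normalClosed G).

Lemma in_subgroup_mulg_closed : mulg_closed (in_subgroup H N).
Proof. by move=> x y xN yN; rewrite unfold_in /in_subgroup valM gpredM. Qed.

Lemma in_subgroup_one : 1 \in in_subgroup H N.
Proof. by rewrite unfold_in /in_subgroup val1 gpred1. Qed.

Lemma in_subgroup_invg_closed : invg_closed (in_subgroup H N).
Proof. by move=> x xN; rewrite unfold_in /in_subgroup gpredVr. Qed.

Lemma in_subgroup_conj_closed x g :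
  x \in in_subgroup H N -> x ^ g \in in_subgroup H N.
Proof. by move=> xN; rewrite unfold_in /in_subgroup !valM conj_closedP. Qed.

HB.instance Definition _ :=
  isMulClosed.Build (subgroup H) (in_subgroup H N) in_subgroup_mulg_closed.
HB.instance Definition _ :=
  isMul1Closed.Build (subgroup H) (in_subgroup H N) in_subgroup_one.
HB.instance Definition _ :=
  isInvClosed.Build (subgroup H) (in_subgroup H N) in_subgroup_invg_closed.
HB.instance Definition _ :=
  isConjClosed.Build (subgroup H) (in_subgroup H N) in_subgroup_conj_closed.
End InSubgroupInstances.

Section QuotientGroup.
Variables (G : groupType) (N : normalClosed G).

Definition qequiv (x y : G) : bool := x / y \in N.

Lemma qequiv_is_equiv : equiv_class_of qequiv.
Proof.
split=> [x|x y|y x z]; rewrite /qequiv.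
- by rewrite divgg gpred1.
- exact: gpredFC.
- by move=> xyN yzN; rewrite -(mulgVK y x) -mulgA gpredM.
Qed.

Canonical qequiv_equiv := EquivRelPack qequiv_is_equiv.
Canonical qequiv_encModRel := defaultEncModRel qequiv.

Definition quotient_group := {eq_quot qequiv}.

HB.instance Definition _ : EqQuotient G qequiv quotient_group :=
  EqQuotient.on quotient_group.
HB.instance Definition _ := Choice.on quotient_group.

Definition qone : quotient_group := lift_cst quotient_group 1.
Definition qmul := lift_op2 quotient_group (fun x y : G => x * y).
Definition qinv := lift_op1 quotient_group (fun x : G => x^-1).

Canonical pi_qone_morph := PiConst qone.

Lemma qequivE x y : (x / y \in N) = (x == y %[mod quotient_group]).
Proof. by rewrite piE. Qed.

Lemma pi_qinv : {morph \pi : x / x^-1 >-> qinv x}.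
Proof.
move=> x; unlock qinv; apply/eqP; rewrite -qequivE invgK.
set y := repr _; have xyN : y / x \in N by rewrite qequivE reprK.
have -> : x^-1 * y = (y / x) ^ x by rewrite conjgE mulgVK.
exact: conj_closedP.
Qed.
Canonical pi_qinv_morph := PiMorph1 pi_qinv.

Lemma pi_qmul : {morph \pi : x y / x * y >-> qmul x y}.
Proof.
move=> x y; unlock qmul; apply/eqP; rewrite -qequivE.
set x' := repr _; set y' := repr _.
have xN : x / x' \in N by rewrite qequivE reprK.
have yN : y / y' \in N by rewrite qequivE reprK.
have -> : (x * y) / (x' * y') = (y / y') ^ x^-1 * (x / x').
  by rewrite conjgE invgK invgM !mulgA mulgVK.
by rewrite gpredM // conj_closedP.
Qed.
Canonical pi_qmul_morph := PiMorph2 pi_qmul.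

Lemma qmulA : associative qmul.
Proof. by move=> x y z; rewrite -[x]reprK -[y]reprK -[z]reprK !piE mulgA. Qed.

Lemma qmul1g : left_id qone qmul.
Proof. by move=> x; rewrite -[x]reprK !piE mul1g. Qed.

Lemma qmulg1 : right_id qone qmul.
Proof. by move=> x; rewrite -[x]reprK !piE mulg1. Qed.

Lemma qmulVg : left_inverse qone qinv qmul.
Proof. by move=> x; rewrite -[x]reprK !piE mulVg. Qed.

Lemma qmulgV : right_inverse qone qinv qmul.
Proof. by move=> x; rewrite -[x]reprK !piE mulgV. Qed.

HB.instance Definition _ :=
  isGroup.Build quotient_group qmulA qmul1g qmulg1 qmulVg qmulgV.
End QuotientGroup.

(* [H_2(U)] with trivial integer coefficients, from the (unnormalised,
   inhomogeneous) bar resolution: the complex of coinvariants has the free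
   abelian group on [U^n] in degree [n], and
     d2 [g|h]   = [h] - [gh] + [g],
     d3 [g|h|k] = [h|k] - [gh|k] + [g|hk] - [g|h]. *)
Section SecondHomology.
Variable U : groupType.

Definition bar_d2 : {freeg (U * U)%type / int} -> {freeg U / int} :=
  fglift (fun p : U * U =>
    let: (g, h) := p in << h >> - << (g * h)%g >> + << g >>)%R.

Definition bar_d3 :
    {freeg (U * U * U)%type / int} -> {freeg (U * U)%type / int} :=
  fglift (fun p : U * U * U =>
    let: (g, h, k) := p in
    << (h, k) >> - << ((g * h)%g, k) >> + << (g, (h * k)%g) >> - << (g, h) >>)%R.

Lemma bar_d2_additive : {morph bar_d2 : x y / (x - y)%R}.
Proof. exact: lift_is_additive. Qed.

Lemma bar_d3_additive : {morph bar_d3 : x y / (x - y)%R}.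
Proof. exact: lift_is_additive. Qed.

HB.instance Definition _ := GRing.isZmodMorphism.Build _ _ bar_d2 bar_d2_additive.
HB.instance Definition _ := GRing.isZmodMorphism.Build _ _ bar_d3 bar_d3_additive.

Lemma bar_d2_d3 z : bar_d2 (bar_d3 z) = 0%R.
Proof.
rewrite -(freeg_sumE z) !raddf_sum big1 // => -[[g h] k] _.
rewrite -[coeff _ _]intz -freegU_mulz 2!raddfMz /=.
have -> : bar_d3 << (g, h, k) >> =
    (<< (h, k) >> - << ((g * h)%g, k) >> + << (g, (h * k)%g) >> - << (g, h) >>)%R.
  by rewrite [LHS]liftU scale1r.
rewrite !(raddfB, raddfD) /= /bar_d2 !liftU !scale1r mulgA.
rewrite (_ : (_ - _)%R = 0%R) ?mul0rz //.
by apply/eqP/freeg_eqP => x; rewrite !(coeffB, coeffD, coeff0); ring.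
Qed.

Definition cycle2 : {pred {freeg (U * U)%type / int}} :=
  fun z => bar_d2 z == 0%R.

Lemma cycle2_zmod_closed : zmod_closed cycle2.
Proof.
split=> [|x y /eqP dx /eqP dy]; rewrite unfold_in /cycle2; apply/eqP.
  exact: raddf0.
by rewrite bar_d2_additive dx dy subr0.
Qed.
HB.instance Definition _ :=
  GRing.isZmodClosed.Build _ cycle2 cycle2_zmod_closed.

Record Z2 := MkZ2 { Z2_val : {freeg (U * U)%type / int}; _ : Z2_val \in cycle2 }.
HB.instance Definition _ := [isSub for Z2_val].
HB.instance Definition _ := [Choice of Z2 by <:].
HB.instance Definition _ := [SubChoice_isSubZmodule of Z2 by <:].

Definition B2 : {pred Z2} := fun z => `[< exists c, val z = bar_d3 c >].

Lemma B2_zmod_closed : zmod_closed B2.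
Proof.
split=> [|x y /asboolP[c cx] /asboolP[d dy]]; apply/asboolP.
  by exists 0%R; rewrite [RHS]raddf0 [LHS]raddf0.
by exists (c - d)%R; rewrite bar_d3_additive -cx -dy [LHS]raddfB.
Qed.
HB.instance Definition _ := GRing.isZmodClosed.Build _ B2 B2_zmod_closed.

Definition H2 : zmodType := Quotient.quot B2.
End SecondHomology.

(* Main.v *)
Require Import Defs.
From HB Require Import structures.
From mathcomp Require Import all_boot all_algebra.
From mathcomp Require Import boolp classical_sets.
From mathcomp.multinomials Require Import freeg.

(** Put [P = N1 N2] and [K = N1 /\ N2], and let [x ^+ n] lie in [[N1, N2]].
    Since [[N1, N2]] is contained in [[F, N1]] and in [[F, N2]], the torsion
    hypotheses on [F / [F, Ni]] place [x] in both [[F, Ni]], hence in [K], and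
    everything that remains happens inside [P].

    The homotopy pushout of [B(P/N1) <- BP -> B(P/N2)] is simply connected and
    its second homotopy group is [K / [N1, N2]].  As [P] is free,
    [H_2(P) = 0], and Mayer-Vietoris becomes the exact sequence
      [0 -> H_2(P/N1) + H_2(P/N2) -> K / [N1, N2] -> P / [P, P]],
    whose outer terms are torsion-free.  So the middle one is torsion-free too.

    The proof carries out this argument by pure algebra, as three successive
    statements about [x]:
    - [x] lies in [[P, P]], because the abelianization of [P] is torsion-free
      ([projective_abelianization_tf]);
    - [x] lies in [[P, N1]] and in [[P, N2]]: by Hopf's formula the quotient
      [(Ni /\ [P, P]) / [P, Ni]] embeds in [H_2(P/Ni)]
      ([hopf_torsion_free]);
    - [[P, N1] /\ [P, N2] = [N1, N2]] ([commsub_cap]), so that the kernel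
      [(K /\ [P, P]) / [N1, N2]] of the last map above embeds in the sum of these
      quotients, hence in [H_2(P/N1) + H_2(P/N2)].

    The freeness of [P] enters each of them only through the lifting property
    of homomorphisms along surjections.  That a normal subgroup [N] of a free
    group [F] has this property is shown without the Nielsen-Schreier theorem,
    by embedding [F] in a wreath product over [F / N] and lifting this
    embedding, which is possible since [F] is free
    ([free_normal_projective]). *)

Set Implicit Arguments.
Unset Strict Implicit.
Unset Printing Implicit Defensive.

Import GRing.Theory.

Local Open Scope classical_set_scope.
Local Open Scope quotient_scope.
Local Open Scope group_scope.

Local Notation "{ 'hom' G -> H }" := (UMagmaMorphism.type G H)
  (at level 0, G at level 98, H at level 99).

(** * Homomorphisms, quotients and commutator subgroups *)

Section MorphHom.
Variables (G H : groupType) (f : G -> H) (fM : {morph f : x y / x * y}).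

Let f1 : f 1 = 1.
Proof. by apply: (@mulgI _ (f 1)); rewrite -fM !mulg1. Qed.

Definition morph_hom : {hom G -> H} :=
  HB.pack f (isUMagmaMorphism.Build G H f (f1, fM)).
End MorphHom.

Section Quotients.
Variables (G : groupType) (N : normalClosed G).

Definition qproj (x : G) : quotient_group N := \pi x.

Lemma qproj_morph : {morph qproj : x y / x * y}.
Proof. by move=> x y; rewrite /qproj pi_qmul. Qed.

HB.instance Definition _ := UMagmaMorphism.copy qproj (morph_hom qproj_morph).

Lemma qproj_eqP x y : reflect (qproj x = qproj y) (x / y \in N).
Proof. by rewrite qequivE; apply: eqP. Qed.

Lemma qproj_eq1 x : (qproj x == 1) = (x \in N).
Proof.
have qproj1 : qproj 1 = 1 by exact: gmulf1.
by rewrite -[x in RHS]divg1 -qproj1; apply/eqP/qproj_eqP.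
Qed.

Lemma qproj_repr (q : quotient_group N) : qproj (repr q) = q.
Proof. exact: reprK. Qed.

Lemma qproj_surj (q : quotient_group N) : exists x, qproj x = q.
Proof. by exists (repr q); rewrite qproj_repr. Qed.

Lemma torsion_free_quotientP :
  torsion_free (quotient_group N) <->
  forall x n, (0 < n)%N -> x ^+ n \in N -> x \in N.
Proof.
split=> tf x n n0.
  by rewrite -!qproj_eq1 gmulfXn => /eqP /(tf _ _ n0) ->.
have [y <-] := qproj_surj x; rewrite -gmulfXn => /eqP; rewrite qproj_eq1.
by move=> /(tf _ _ n0); rewrite -qproj_eq1 => /eqP.
Qed.
End Quotients.
Arguments qproj {G} N x.

Section Commutators.
Variables (G : groupType).

Lemma commsub_gen (M N : {pred G}) g h :
  g \in M -> h \in N -> [~ g, h] \in commsub M N.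
Proof. by move=> gM hN; apply/asboolP => H _; apply; exists g, h. Qed.

Lemma commsub_min (M N : {pred G}) (H : groupClosed G) :
  (forall g h, g \in M -> h \in N -> [~ g, h] \in H) ->
  {subset commsub M N <= H}.
Proof.
move=> MNH x /asboolP; apply; first by split; [exact: gpred1 | exact: gpredF].
by move=> _ [g [h [gM hN ->]]]; apply: MNH.
Qed.

Lemma commsub_sub2 (M N : normalClosed G) :
  {subset commsub M N <= commsub (full G) N}.
Proof. by apply: commsub_min => g h _ hN; apply: commsub_gen. Qed.

Lemma commsub_sub1 (M N : normalClosed G) :
  {subset commsub M N <= commsub (full G) M}.
Proof.
by apply: commsub_min => g h gM _; rewrite -invgR gpredV; apply: commsub_gen.
Qed.

Lemma commsub_full_sub (N : normalClosed G) :
  {subset commsub (full G) N <= N}.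
Proof.
by apply: commsub_min => g h _ hN; rewrite commgEr gpredM ?conj_closedP ?gpredV.
Qed.

End Commutators.

Section Equalizer.
Variables (G H : groupType) (f g : {hom G -> H}).
Definition equalizer : {pred G} := fun x => f x == g x.

Lemma equalizer_mulg : mulg_closed equalizer.
Proof.
by move=> x y /eqP fx /eqP fy; apply/eqP; rewrite !gmulfM /= fx fy.
Qed.
Lemma equalizer_one : 1 \in equalizer.
Proof. by apply/eqP; rewrite !gmulf1. Qed.
Lemma equalizer_invg : invg_closed equalizer.
Proof. by move=> x /eqP fx; apply/eqP; rewrite !gmulfV /= fx. Qed.

HB.instance Definition _ := isMulClosed.Build G equalizer equalizer_mulg.
HB.instance Definition _ := isMul1Closed.Build G equalizer equalizer_one.
HB.instance Definition _ := isInvClosed.Build G equalizer equalizer_invg.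
End Equalizer.

Section Preimage.
Variables (G H : groupType) (f : {hom G -> H}) (S : groupClosed H).
Definition hpreim : {pred G} := fun x => f x \in S.

Lemma hpreim_mulg : mulg_closed hpreim.
Proof. by move=> x y fx fy; rewrite unfold_in /hpreim gmulfM gpredM. Qed.
Lemma hpreim_one : 1 \in hpreim.
Proof. by rewrite unfold_in /hpreim gmulf1 gpred1. Qed.
Lemma hpreim_invg : invg_closed hpreim.
Proof. by move=> x fx; rewrite unfold_in /hpreim gmulfV gpredV. Qed.

HB.instance Definition _ := isMulClosed.Build G hpreim hpreim_mulg.
HB.instance Definition _ := isMul1Closed.Build G hpreim hpreim_one.
HB.instance Definition _ := isInvClosed.Build G hpreim hpreim_invg.
End Preimage.

Section Image.
Variables (G H : groupType) (f : {hom G -> H}) (S : groupClosed G).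
Definition himage : {pred H} := fun y => `[< exists2 x, x \in S & y = f x >].

Lemma himage_mulg : mulg_closed himage.
Proof.
move=> _ _ /asboolP[x xS ->] /asboolP[y yS ->]; apply/asboolP.
by exists (x * y); rewrite ?gpredM ?gmulfM.
Qed.
Lemma himage_one : 1 \in himage.
Proof. by apply/asboolP; exists 1; rewrite ?gpred1 ?gmulf1. Qed.
Lemma himage_invg : invg_closed himage.
Proof.
move=> _ /asboolP[x xS ->]; apply/asboolP.
by exists x^-1; rewrite ?gpredV ?gmulfV.
Qed.

HB.instance Definition _ := isMulClosed.Build H himage himage_mulg.
HB.instance Definition _ := isMul1Closed.Build H himage himage_one.
HB.instance Definition _ := isInvClosed.Build H himage himage_invg.
End Image.

(** * Projective groups and normal subgroups of free groups *)

Definition projective (P : groupType) : Prop :=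
  forall (G H : groupType) (p : {hom G -> H}) (f : {hom P -> H}),
  (forall h, exists g, p g = h) ->
  exists phi : {hom P -> G}, forall x, p (phi x) = f x.

Section Wreath.
Variables (A C : groupType).

(** The regular wreath product suffices below: the subgroup under study is
    normal, so the action on its cosets is the regular action of the quotient. *)
Record wreath := Wreath { wbase : C -> A; wtop : C }.

HB.instance Definition _ := gen_eqMixin wreath.
HB.instance Definition _ := gen_choiceMixin wreath.

Lemma wreath_eqP (a b : wreath) :
  wbase a =1 wbase b -> wtop a = wtop b -> a = b.
Proof. by case: a b => [a c] [b d] /= /funext -> ->. Qed.

Definition wmul a b :=
  Wreath (fun e => wbase a e * wbase b (e * wtop a)) (wtop a * wtop b).
Definition wone := Wreath (fun=> 1) 1.
Definition winv a := Wreath (fun e => (wbase a (e / wtop a))^-1) (wtop a)^-1.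

Lemma wmulA : associative wmul.
Proof. by move=> a b c; apply: wreath_eqP => [e|] /=; rewrite !mulgA. Qed.
Lemma wmul1g : left_id wone wmul.
Proof. by move=> a; apply: wreath_eqP => [e|] /=; rewrite ?mulg1 mul1g. Qed.
Lemma wmulg1 : right_id wone wmul.
Proof. by move=> a; apply: wreath_eqP => [e|] /=; rewrite mulg1. Qed.
Lemma wmulVg : left_inverse wone winv wmul.
Proof. by move=> a; apply: wreath_eqP => [e|] /=; rewrite mulVg. Qed.
Lemma wmulgV : right_inverse wone winv wmul.
Proof. by move=> a; apply: wreath_eqP => [e|] /=; rewrite ?mulgK mulgV. Qed.

HB.instance Definition _ :=
  isGroup.Build wreath wmulA wmul1g wmulg1 wmulVg wmulgV.

End Wreath.

Definition wreath_map (A B C : groupType) (p : {hom A -> B}) (a : wreath A C) :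
  wreath B C := Wreath (p \o wbase a) (wtop a).

Lemma wreath_map_morph A B C p : {morph @wreath_map A B C p : a b / a * b}.
Proof. by move=> a b; apply: wreath_eqP => [e|] //=; rewrite gmulfM. Qed.

Section FrobeniusEmbedding.
Variables (G H : groupType) (N : normalClosed G) (f : {hom subgroup N -> H}).
Local Notation C := (quotient_group N).

(** Dividing by [repr 1] makes the representative of the trivial coset equal
    to [1], which is what [frobenius_subgroup] relies on. *)
Definition transversal (e : C) : G := repr e / repr (1 : C).

Lemma qproj_transversal e : qproj N (transversal e) = e.
Proof. by rewrite gmulfF /= !qproj_repr divg1. Qed.

(** The Schreier generator attached to the coset [e] and the element [x]. *)
Definition wcocycle (e : C) (x : G) : G :=
  transversal e * x / transversal (e * qproj N x).

Lemma wcocycle_mem e x : wcocycle e x \in N.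
Proof. by apply/qproj_eqP; rewrite qproj_morph !qproj_transversal. Qed.

Lemma wcocycleM e x y :
  wcocycle e (x * y) = wcocycle e x * wcocycle (e * qproj N x) y.
Proof.
rewrite /wcocycle qproj_morph [e * (_ * _)]mulgA.
by move: (transversal (e * _)) => t; rewrite !mulgA mulgVK.
Qed.

(** The homomorphism induced from [f]: the Frobenius and
    Kaloujnine-Krasner construction, landing in the wreath product by [G / N]. *)
Definition frobenius (x : G) : wreath H C :=
  Wreath (fun e => f (Subgroup (wcocycle_mem e x))) (qproj N x).

Lemma frobenius_morph : {morph frobenius : x y / x * y}.
Proof.
move=> x y; apply: wreath_eqP => [e|] /=; last exact: gmulfM.
by rewrite -gmulfM; congr (f _); apply: val_inj; rewrite valM /= wcocycleM.
Qed.

(** [f] can be read off the induced homomorphism, at the trivial coset. *)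
Lemma frobenius_subgroup (y : subgroup N) : wbase (frobenius (val y)) 1 = f y.
Proof.
congr (f _); apply: val_inj; rewrite /= /wcocycle.
have /eqP-> : qproj N (val y) == 1 by rewrite qproj_eq1 (valP y).
by rewrite mulg1 /transversal divgg mul1g divg1.
Qed.
End FrobeniusEmbedding.

(** A homomorphism [f] on [N] is lifted by inducing it to [F], lifting the
    induced homomorphism coordinatewise on a basis, and evaluating the result at
    the trivial coset.  This evaluation is multiplicative on [N] because [N] acts
    trivially on the cosets. *)
Lemma free_normal_projective (F : groupType) (X : set F) (N : normalClosed F) :
  free_basis X -> projective (subgroup N).
Proof.
move=> freeF G H p f p_surj; have [s sK] := choice p_surj.
pose lift x : wreath G (quotient_group N) :=
  Wreath (s \o wbase (frobenius f x)) (qproj N x).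
have [[Phi PhiM PhiX] _] := freeF _ lift.
have [_ uniq_hom] := freeF _ (frobenius f).
have Phi_frob x : wreath_map p (Phi x) = frobenius f x.
  apply: (uniq_hom (wreath_map p \o Phi)) => [a b|a b|a Xa] /=.
  - by rewrite PhiM wreath_map_morph.
  - exact: frobenius_morph.
  - by rewrite PhiX //; apply: wreath_eqP => // e; exact: sK.
have Phi_top (y : subgroup N) : wtop (Phi (val y)) = 1.
  apply/eqP; have /(congr1 (@wtop _ _)) /= -> := Phi_frob (val y).
  by rewrite qproj_eq1 (valP y).
have phiM : {morph (fun y : subgroup N => wbase (Phi (val y)) 1) :
    x y / x * y}.
  move=> x y; rewrite [val (x * y)]valM PhiM.
  by rewrite /= Phi_top mulg1.
exists (morph_hom phiM) => y /=.
by rewrite -frobenius_subgroup -Phi_frob.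
Qed.

(** * Central elements *)

Lemma conjg_commute (G : groupType) (x y : G) : commute x y -> x ^ y = x.
Proof. by move=> /commgP; rewrite -conjg_fix => /eqP. Qed.

Lemma commgMM (G : groupType) (a b m k : G) :
    commute k (a * m) -> commute k b -> commute m b -> commute m [~ a, b] ->
  [~ a * m, b * k] = [~ a, b].
Proof.
move=> kam kb mb mab; rewrite commgEl conjgM conjg_commute; last first.
  by apply/commute_sym/commuteM; [apply: commuteV | apply: commuteM].
rewrite conjMg (conjg_commute mb) invgM mulgA -(mulgA m^-1) -commgEl.
by rewrite -mulgA -conjgE; apply/conjg_commute/commute_sym.
Qed.

Definition central (G : groupType) : {pred G} :=
  fun x => `[< forall y, commute x y >].
Arguments central G : clear implicits.

Section Center.
Variable G : groupType.

Lemma centralP x : reflect (forall y, commute x y) (x \in central G).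
Proof. exact: asboolP. Qed.

Lemma central_mulg : mulg_closed (central G).
Proof.
move=> x y /centralP cx /centralP cy; apply/centralP => z.
by apply/commute_sym/commuteM; apply/commute_sym.
Qed.
Lemma central_one : 1 \in central G.
Proof. by apply/centralP => y; apply/commute_sym/commute1. Qed.
Lemma central_invg : invg_closed (central G).
Proof.
move=> x /centralP cx; apply/centralP => z.
by apply/commute_sym/commuteV/commute_sym.
Qed.

HB.instance Definition _ := isMulClosed.Build G (central G) central_mulg.
HB.instance Definition _ := isMul1Closed.Build G (central G) central_one.
HB.instance Definition _ := isInvClosed.Build G (central G) central_invg.

(** The centre with additive notation, so that it can receive homomorphisms
    from free abelian groups. *)
Definition center := subgroup (central G).

HB.instance Definition _ := Choice.on center.

Lemma center_mulC : commutative ( *%g : center -> center -> center).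
Proof.
by move=> x y; apply: val_inj; rewrite !valM; apply/centralP/(valP x).
Qed.

HB.instance Definition _ := GRing.isZmodule.Build center
  (@mulgA (subgroup (central G))) center_mulC
  (@mul1g (subgroup (central G))) (@mulVg (subgroup (central G))).

Definition cval (x : center) : G := val x.

Lemma cvalD x y : cval (x + y)%R = cval x * cval y.
Proof. exact: (valM (x : subgroup (central G))). Qed.

Lemma cval_inj : injective cval.
Proof. exact: val_inj. Qed.

Lemma cval_commute (x : center) y : commute (cval x) y.
Proof. by apply/centralP/(valP x). Qed.

End Center.

Lemma central_hom_commsub (G H : groupType) (f : {hom G -> H}) (N : {pred G}) :
    {in N, forall y, f y \in central H} ->
  {in commsub (full G) N, forall x, f x = 1}.
Proof.
move=> fN x; suff sub : {subset commsub (full G) N <= equalizer f (one_fun H)}.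
  by move/sub/eqP.
apply: commsub_min => g h _ /fN /centralP fh; apply/eqP; rewrite gmulfR /=.
exact/eqP/commgP/commute_sym.
Qed.

(** Commutators are insensitive to central factors. *)
Lemma central_diff_commsub (G H : groupType) (f g : {hom G -> H}) :
    (forall y, exists2 c, c \in central H & f y = g y * c) ->
  {in commsub (full G) (full G), f =1 g}.
Proof.
move=> fg x; suff sub : {subset commsub (full G) (full G) <= equalizer f g}.
  by move/sub/eqP.
apply: commsub_min => y z _ _; apply/eqP; rewrite !gmulfR.
have [c /centralP cC ->] := fg y; have [d /centralP dC ->] := fg z.
exact: commgMM.
Qed.

(** * Torsion in the abelianization *)

Section FreeAbelian.
Variables (K : choiceType) (A : zmodType).
Local Open Scope ring_scope.

Definition fgext (f : K -> A) : {freeg K / int} -> A :=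
  fglift (f : K -> zmodule A).

Lemma fgext_additive f : {morph fgext f : x y / x - y}.
Proof. exact: (lift_is_additive (f : K -> zmodule A)). Qed.

HB.instance Definition _ f :=
  GRing.isZmodMorphism.Build {freeg K / int} A (fgext f) (fgext_additive f).

Lemma fgextU f k : fgext f << k >> = f k.
Proof. by rewrite /fgext liftU scale1r. Qed.

Lemma freeg_hom_eq (f g : {additive {freeg K / int} -> A}) :
  (forall k, f << k >> = g << k >>) -> f =1 g.
Proof.
move=> fg z; rewrite -(freeg_sumE z) !raddf_sum; apply: eq_bigr => k _.
by rewrite -[coeff _ _]intz -freegU_mulz !raddfMz /= fg.
Qed.

Lemma freeg_torsion_free : torsion_free_zmod {freeg K / int}.
Proof.
move=> z n n0 zn; apply/eqP/freeg_eqP => k; apply/eqP; rewrite coeff0.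
have /eqP := congr1 (coeff k) zn; rewrite coeffMn coeff0 Num.Theory.mulrn_eq0.
by rewrite eqn0Ngt n0.
Qed.
End FreeAbelian.

Section MulGroup.
Variable A : zmodType.
Definition mulgroup : Type := A.
HB.instance Definition _ := Choice.on mulgroup.
HB.instance Definition _ := isGroup.Build mulgroup
  (@addrA A) (@add0r A) (@addr0 A) (@addNr A) (@addrN A).

Lemma mulgroupX (x : mulgroup) n : x ^+ n = ((x : A) *+ n)%R.
Proof. by elim: n => // n IH; rewrite expgS IH mulrS. Qed.
End MulGroup.

(** The projection of [P] on its abelianization lifts to the free abelian group
    on the elements of that abelianization.  Being torsion-free and abelian, the
    latter kills an [x] with [x ^+ n] in [[P, P]]. *)
Lemma projective_abelianization_tf (P : groupType) : projective P ->
  forall x n, (0 < n)%N -> x ^+ n \in commsub (full P) (full P) ->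
  x \in commsub (full P) (full P).
Proof.
move=> projP x n n0 xn; set D := commsub _ _ in xn *.
have cen (q : quotient_group D) : q \in central _.
  apply/centralP => r; have [y <-] := qproj_surj q; have [z <-] := qproj_surj r.
  by apply/commgP; rewrite -gmulfR qproj_eq1 commsub_gen.
pose Z := center (quotient_group D).
pose p (w : mulgroup {freeg (quotient_group D) / int}) :=
  cval (fgext (fun q => Subgroup (cen q) : Z) w).
have pM : {morph p : v w / v * w}.
  by move=> v w; rewrite /p -cvalD -raddfD.
have [|phi phiE] := projP _ _ (morph_hom pM) (qproj D).
  by move=> q; exists << q >>%R; rewrite /= /p fgextU.
rewrite -qproj_eq1 -phiE.
suff -> : phi x = 1 by rewrite gmulf1.
apply: (freeg_torsion_free n0); rewrite -mulgroupX -gmulfXn.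
apply: (central_hom_commsub (f := phi)) xn => y _; apply/centralP => z.
exact: addrC.
Qed.

(** * The tautological central extension *)

Section BarChains.
Variable U : groupType.
Local Notation C2 := {freeg (U * U)%type / int}.

Lemma bar_d2U (g h : U) :
  bar_d2 << (g, h) >>%R = (<< h >> - << (g * h)%g >> + << g >>)%R.
Proof. by rewrite [LHS]liftU scale1r. Qed.

Lemma bar_d3U (g h k : U) : bar_d3 << (g, h, k) >>%R =
  (<< (h, k) >> - << ((g * h)%g, k) >> + << (g, (h * k)%g) >> - << (g, h) >>)%R.
Proof. by rewrite [LHS]liftU scale1r. Qed.

Definition boundary2 : {pred C2} := fun z => `[< exists c, z = bar_d3 c >].

Lemma boundary2P z : reflect (exists c, z = bar_d3 c) (z \in boundary2).
Proof. exact: asboolP. Qed.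

Lemma boundary2_zmod_closed : zmod_closed boundary2.
Proof.
split=> [|x y /boundary2P[c ->] /boundary2P[d ->]]; apply/boundary2P.
  by exists 0%R; rewrite raddf0.
by exists (c - d)%R; rewrite raddfB.
Qed.
HB.instance Definition _ :=
  GRing.isZmodClosed.Build _ boundary2 boundary2_zmod_closed.

(** Two-chains modulo boundaries: the target of the universal 2-cocycle, which
    contains [H_2(U)] as the kernel of the boundary map. *)
Definition chains : zmodType := Quotient.quot boundary2.

Definition chain (z : C2) : chains := \pi z.

Lemma chain_additive : {morph chain : x y / (x - y)%R}.
Proof. by move=> x y; rewrite /chain raddfB. Qed.
HB.instance Definition _ := GRing.isZmodMorphism.Build _ _ chain chain_additive.

Lemma chain_repr m : chain (repr m) = m.
Proof. exact: reprK. Qed.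

Lemma chain_eqP x y : reflect (chain x = chain y) ((x - y)%R \in boundary2).
Proof. by rewrite Quotient.idealrBE; apply: eqP. Qed.

Section Extension.
Variables (A : zmodType) (f : {additive C2 -> A}).
Hypothesis f_d3 : forall c, f (bar_d3 c) = 0%R.

Definition chain_ext of (forall c, f (bar_d3 c) = 0%R) :=
  fun m : chains => f (repr m).

Lemma chain_extE z : chain_ext f_d3 (chain z) = f z.
Proof.
apply/eqP; rewrite -subr_eq0 -raddfB.
have /chain_eqP/boundary2P[c ->] := chain_repr (chain z).
by rewrite f_d3.
Qed.

Lemma chain_ext_additive : {morph chain_ext f_d3 : x y / (x - y)%R}.
Proof.
move=> x y; rewrite -[in LHS](chain_repr x) -[in LHS](chain_repr y).
by rewrite -raddfB chain_extE raddfB.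
Qed.

HB.instance Definition _ := GRing.isZmodMorphism.Build chains A
  (chain_ext f_d3) chain_ext_additive.
End Extension.
End BarChains.
Arguments chain_ext {U A f} _ _ : simpl never.

Section TautologicalExtension.
Variable U : groupType.
Local Notation chains := (chains U).

Definition symbol (g h : U) : chains := chain << (g, h) >>%R.

(** The formula for [bar_d3] is exactly the 2-cocycle identity. *)
Lemma symbol_cocycle g h k :
  (symbol h k + symbol g (h * k)%g = symbol (g * h)%g k + symbol g h)%R.
Proof.
rewrite /symbol -!raddfD; apply/chain_eqP/boundary2P; exists << (g, h, k) >>%R.
by rewrite bar_d3U opprD addrA; congr (_ - _)%R; rewrite addrAC.
Qed.

Lemma symbol1l g : symbol 1 g = symbol 1 1.
Proof. by have := symbol_cocycle 1 1 g; rewrite !mul1g => /addrI. Qed.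

Lemma symbol1r g : symbol g 1 = symbol 1 1.
Proof.
by have := symbol_cocycle g 1 1; rewrite !mulg1 => /addIr.
Qed.

Lemma symbolVr g : symbol g g^-1 = symbol g^-1 g.
Proof.
have := symbol_cocycle g g^-1 g.
by rewrite mulVg mulgV symbol1l symbol1r addrC => /addrI.
Qed.

(** The extension of [U] by [chains] that the cocycle [symbol] defines.  As the
    cocycle is not normalised, the identity element is [(- [1|1], 1)]. *)
Record taut := Taut { tfib : chains; tbase : U }.

HB.instance Definition _ := gen_eqMixin taut.
HB.instance Definition _ := gen_choiceMixin taut.

Definition tmul a b := Taut
  (tfib a + tfib b + symbol (tbase a) (tbase b))%R (tbase a * tbase b).
Definition tone := Taut (- symbol 1 1)%R 1.
Definition tinv a := Taut
  (- tfib a - symbol (tbase a)^-1 (tbase a) - symbol 1 1)%R (tbase a)^-1.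

Lemma tmulA : associative tmul.
Proof.
move=> a b c; congr Taut => /=; last exact: mulgA.
rewrite -!addrA symbol_cocycle; congr (_ + (_ + _))%R.
by rewrite [RHS]addrCA; congr (_ + _)%R; apply: addrC.
Qed.
Lemma tmul1g : left_id tone tmul.
Proof.
by case=> m g; congr Taut => /=; rewrite ?mul1g // symbol1l addrAC addNr add0r.
Qed.
Lemma tmulg1 : right_id tone tmul.
Proof. by case=> m g; congr Taut => /=; rewrite ?mulg1 // symbol1r addrNK. Qed.
Lemma tmulVg : left_inverse tone tinv tmul.
Proof.
case=> m g; congr Taut => /=; rewrite ?mulVg //.
by rewrite (addrAC _ _ m) (addrAC _ _ m) addNr add0r addrAC addNr add0r.
Qed.
Lemma tmulgV : right_inverse tone tinv tmul.
Proof.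
case=> m g; congr Taut => /=; rewrite ?mulgV // symbolVr.
by rewrite !addrA addrN add0r addrAC addNr add0r.
Qed.

HB.instance Definition _ :=
  isGroup.Build taut tmulA tmul1g tmulg1 tmulVg tmulgV.

Lemma tbase_morph : {morph tbase : a b / a * b}.
Proof. by []. Qed.
HB.instance Definition _ := UMagmaMorphism.copy tbase (morph_hom tbase_morph).

Lemma tbase1_central a : tbase a = 1 -> a \in central taut.
Proof.
move=> a1; apply/centralP => b; congr Taut => /=; rewrite a1 ?mulg1 ?mul1g //.
by rewrite symbol1l symbol1r (addrC (tfib a)).
Qed.

(** On the fibre over [1] the group law becomes the addition of [chains] after a
    shift by [[1|1]]. *)
Lemma tfib_expg a n : tbase a = 1 ->
  (tfib (a ^+ n)%g + symbol 1 1 = (tfib a + symbol 1 1) *+ n)%R.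
Proof.
move=> a1; elim: n => [|n IH]; first by rewrite /= addNr.
have an1 : tbase (a ^+ n) = 1 by rewrite gmulfXn /= a1 expg1n.
by rewrite expgS mulrS -IH /= a1 an1 addrACA addrA.
Qed.

(** The boundary map extends to a homomorphism on the whole extension, because
    [bar_d2 [g|h]] measures the failure of [g |-> [g]] to be additive.  On the
    fibre over [1] its vanishing says that the shifted chain is a cycle. *)
Definition delta (a : taut) : {freeg U / int} :=
  (chain_ext (@bar_d2_d3 U) (tfib a) + << tbase a >>)%R.

Lemma deltaM : {morph delta : a b / a * b >-> (a + b)%R}.
Proof.
move=> a b; rewrite /delta /= !raddfD /=.
rewrite [chain_ext _ (symbol _ _)]chain_extE /= bar_d2U.
rewrite [RHS]addrACA -[LHS]addrA; congr (_ + _)%R.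
by rewrite addrAC addrNK addrC.
Qed.

Lemma delta1 : delta 1 = 0%R.
Proof. by apply: (@addrI _ (delta 1)); rewrite -deltaM mulg1 addr0. Qed.

Lemma deltaX a n : delta (a ^+ n) = (delta a *+ n)%R.
Proof. by elim: n => [|n IH]; rewrite ?delta1 // expgS mulrS deltaM IH. Qed.

End TautologicalExtension.

(** * Torsion and the formula of Hopf *)

Section Hopf.
Variables (P : groupType) (N : normalClosed P).
Local Notation U := (quotient_group N).
Local Notation K := (commsub (full P) N).
Local Notation E := (quotient_group K).

Lemma qproj_central y : y \in N -> qproj K y \in central E.
Proof.
move=> yN; apply/centralP => e; have [z <-] := qproj_surj e.
apply/commute_sym/commgP; rewrite -(gmulfR (qproj K)) qproj_eq1.
exact: commsub_gen.
Qed.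

Definition qsection (u : U) : E := qproj K (repr u).

(** The factor set of the central extension [E] of [U] for the section
    [qsection]. *)
Definition factor (p : U * U) : E :=
  qsection p.1 * qsection p.2 / qsection (p.1 * p.2).

Lemma factor_central p : factor p \in central E.
Proof.
rewrite /factor /qsection -!qproj_morph -(gmulfF (qproj K)).
by apply/qproj_central/qproj_eqP; rewrite qproj_morph !qproj_repr.
Qed.

Definition factor_ext : {freeg (U * U)%type / int} -> center E :=
  fgext (fun p => Subgroup (factor_central p) : center E).
HB.instance Definition _ := GRing.Additive.copy factor_ext
  (fgext (fun p => Subgroup (factor_central p) : center E)).

Lemma factor_extU p : cval (factor_ext << p >>%R) = factor p.
Proof. by rewrite /factor_ext fgextU. Qed.

Lemma qsection_mul g h :
  qsection g * qsection h = factor (g, h) * qsection (g * h).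
Proof. by rewrite mulgVK. Qed.

(** Both sides of the cocycle identity compare [qsection g * qsection h *
    qsection k] with [qsection (g * h * k)], by associativity. *)
Lemma factor_ext_d3 c : factor_ext (bar_d3 c) = 0%R.
Proof.
apply: (freeg_hom_eq (f := factor_ext \o bar_d3 (U:=U)) (g := \0%R)) c.
case=> [[g h] k] /=; rewrite bar_d3U !(raddfB, raddfD) /=.
apply/eqP; rewrite subr_eq add0r addrAC subr_eq; apply/eqP/cval_inj.
rewrite !cvalD !factor_extU.
have fC p y : commute (factor p) y by apply/centralP/factor_central.
apply: (@mulIg _ (qsection (g * h * k))).
transitivity (qsection g * qsection h * qsection k).
  rewrite -(mulgA g h k) -mulgA -qsection_mul mulgA fC.
  by rewrite -mulgA -qsection_mul mulgA.
by rewrite qsection_mul -mulgA qsection_mul mulgA.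
Qed.

(** Every central extension of [U] receives a map from the tautological one;
    this is the map for [E]. *)
Definition taut_eval (a : taut U) : E :=
  cval (chain_ext factor_ext_d3 (tfib a)) * qsection (tbase a).

Lemma taut_eval_morph : {morph taut_eval : a b / a * b}.
Proof.
move=> a b; rewrite /taut_eval /= !raddfD /= !cvalD.
rewrite [chain_ext _ (symbol _ _)]chain_extE factor_extU.
rewrite -[LHS]mulgA -qsection_mul !mulgA; congr (_ * _).
by rewrite -!mulgA; congr (_ * _); apply: cval_commute.
Qed.
HB.instance Definition _ :=
  UMagmaMorphism.copy taut_eval (morph_hom taut_eval_morph).

(** [H_2(U)] is a subgroup of [chains U], so torsion of a cycle modulo boundaries
    may be tested in either group. *)
Lemma H2_torsion_chain (z : {freeg (U * U)%type / int}) n :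
    torsion_free_zmod (H2 U) -> bar_d2 z = 0%R -> (0 < n)%N ->
  (chain z *+ n)%R = 0%R -> chain z = 0%R.
Proof.
move=> tf dz n0; rewrite -raddfMn -(raddf0 (chain (U:=U))) => /chain_eqP.
rewrite subr0 => /boundary2P[c zc].
apply/chain_eqP; rewrite subr0; apply/boundary2P.
have zZ : z \in cycle2 (U:=U) by apply/eqP.
pose Z := MkZ2 zZ.
have B2P (Y : Z2 U) : (\pi Y : H2 U) = 0%R <-> Y \in B2 (U:=U).
  have := Quotient.idealrBE (B2 (U:=U)) Y 0; rewrite subr0 => ->.
  by rewrite raddf0; split=> /eqP.
suff /B2P/asboolP : (\pi Z : H2 U) = 0%R by [].
apply: (tf _ n) => //; rewrite -raddfMn; apply/B2P/asboolP; exists c.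
by rewrite raddfMn.
Qed.

(** Lift [P -> U] to [phi : P -> taut U].  It kills [[P, N]], so
    [phi x ^+ n = 1]; this makes the shifted chain of [phi x] a cycle whose class
    in [H_2(U)] is torsion, hence zero, and so [phi x = 1].  Finally
    [taut_eval \o phi] and the projection [P -> E] both lift [P -> U], so they
    differ by central elements and agree on [[P, P]], to which [x] belongs. *)
Lemma hopf_torsion_free x n : projective P -> torsion_free_zmod (H2 U) ->
    x \in N -> x \in commsub (full P) (full P) -> (0 < n)%N ->
  x ^+ n \in K -> x \in K.
Proof.
move=> projP tfH xN xD n0 xn.
have [|phi phiE] := projP _ _ (tbase (U:=U)) (qproj N).
  by move=> u; exists (Taut 0%R u).
have phiN y : y \in N -> tbase (phi y) = 1.
  by rewrite phiE -qproj_eq1 => /eqP.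
have phixn : phi x ^+ n = 1.
  rewrite -gmulfXn; apply: central_hom_commsub xn => y yN.
  exact/tbase1_central/phiN.
have dx : delta (phi x) = 0%R.
  by apply: (freeg_torsion_free n0); rewrite -deltaX phixn delta1.
set m := tfib (phi x).
have chainE : chain (repr m + << (1%g, 1%g) >>)%R = (m + symbol 1 1)%R.
  by rewrite raddfD /= chain_repr.
have phix : phi x = 1.
  have mE : (m + symbol 1 1 = 0)%R.
    rewrite -chainE; apply: (H2_torsion_chain tfH _ n0).
      rewrite raddfD /= bar_d2U mulg1 subrr add0r.
      by move: dx; rewrite /delta phiN.
    by rewrite chainE -tfib_expg ?phiN // phixn /= addNr.
  have -> : phi x = Taut m 1 by rewrite -(phiN x xN) /m; case: (phi x).
  by move/eqP: mE; rewrite addr_eq0 => /eqP ->.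
rewrite -qproj_eq1; apply/eqP.
rewrite (central_diff_commsub (f := qproj K) (g := taut_eval \o phi)) //=.
  by rewrite phix gmulf1.
move=> y; rewrite /= /taut_eval phiE.
set z := cval _; set r := repr (qproj N y).
exists (z^-1 * qproj K (r^-1 * y)).
  rewrite gpredM ?gpredV //; first by apply/centralP/cval_commute.
  apply: qproj_central; rewrite -qproj_eq1 qproj_morph (gmulfV (qproj N)) /=.
  by rewrite qproj_repr mulVg.
have zC : commute z^-1 (qsection (qproj N y)).
  exact/commute_sym/commuteV/commute_sym/cval_commute.
rewrite -mulgA [qsection _ * _]mulgA -zC -mulgA mulVKg /qsection -/r.
by rewrite -qproj_morph mulVKg.
Qed.
End Hopf.

(** Since [N1] maps onto [P / N2], there is an endomorphism [f] of [P] with image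
    in [N1] that induces the identity on [P / N2].  It maps [N2] into
    [K = N1 /\ N2], hence [[P, N2]] into [[N1, K]].  On the other hand [f] fixes
    [[P, N1]] modulo [[N1, N2]]: it changes an element of [P] by a factor in
    [N2], which commutes with [N1] modulo [[N1, N2]], and an element of [N1] by a
    factor in [K], which is central modulo [[N1, N2]].  So an element [x] of both
    commutator subgroups is congruent to [f x] and [f x] is in [[N1, N2]]. *)
Lemma commsub_cap (P : groupType) (N1 N2 : normalClosed P) x : projective P ->
    (forall y, y \in prodset N1 N2) ->
    x \in commsub (full P) N1 -> x \in commsub (full P) N2 ->
  x \in commsub N1 N2.
Proof.
move=> projP N12 x1 x2; set D := commsub N1 N2; pose q := qproj D.
have qC a b : a \in N1 -> b \in N2 -> commute (q a) (q b).
  move=> aN1 bN2; apply/commgP.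
  by rewrite -(gmulfR (qproj D)) qproj_eq1 commsub_gen.
have qcapC k y : k \in N1 -> k \in N2 -> commute (q k) (q y).
  move=> k1 k2; have /asboolP[a [b [aN1 bN2 ->]]] := N12 y.
  rewrite /q qproj_morph; apply: commuteM; last exact: qC.
  exact/commute_sym/qC.
have [f fN1 fE] : exists2 f : {hom P -> P},
    forall y, f y \in N1 & forall y, qproj N2 (f y) = qproj N2 y.
  have pM : {morph (qproj N2 \o val : subgroup N1 -> quotient_group N2) :
      a b / a * b}.
    by move=> a b; rewrite /= -qproj_morph; congr qproj; exact: valM.
  have [|phi phiE] := projP _ _ (morph_hom pM) (qproj N2).
    move=> h; have [y <-] := qproj_surj h.
    have /asboolP[a [b [aN1 bN2 ->]]] := N12 y.
    exists (Subgroup aN1) => /=; apply/qproj_eqP.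
    have -> : a / (a * b) = b^-1 ^ a^-1 by rewrite conjgE invgK invgM.
    by rewrite conj_closedP ?gpredV.
  have fM : {morph (fun y => val (phi y)) : y z / y * z}.
    by move=> y z; rewrite gmulfM [LHS]valM.
  by exists (morph_hom fM) => y; [exact: valP | exact: phiE].
have fN2 y : y^-1 * f y \in N2.
  by rewrite -qproj_eq1 qproj_morph fE -qproj_morph mulVg gmulf1.
have qf y : q (f y) = q y * q (y^-1 * f y).
  by rewrite /q -qproj_morph mulVKg.
have fx1 : f x \in D.
  suff /(_ x x2) : {subset commsub (full P) N2 <= hpreim f D} by [].
  apply: commsub_min => y z _ zN2; rewrite unfold_in /hpreim gmulfR.
  apply: commsub_gen; first exact: fN1.
  have -> : f z = z * (z^-1 * f z) by rewrite mulVKg.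
  by rewrite gpredM.
have fx2 : q (f x) = q x.
  suff /(_ x x1)/eqP : {subset commsub (full P) N1 <=
      equalizer (qproj D \o f) (qproj D)} by [].
  apply: commsub_min => y z _ zN1; apply/eqP; rewrite !gmulfR /=.
  rewrite -/q !qf; set m := _^-1 * f y.
  have kN1 : z^-1 * f z \in N1 by rewrite gpredM ?gpredV.
  apply: commgMM.
  - by rewrite -qproj_morph; apply: qcapC.
  - exact: qcapC.
  - by apply/commute_sym/qC; rewrite ?fN2.
  - apply/commute_sym; rewrite -(gmulfR (qproj D)); apply: qC; last exact: fN2.
    by rewrite commgEr gpredM // conj_closedP ?gpredV.
by rewrite -qproj_eq1 -/q -fx2 qproj_eq1.
Qed.

Lemma projective_torsion (P : groupType) (N1 N2 : normalClosed P) :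
    projective P -> (forall y, y \in prodset N1 N2) ->
    torsion_free_zmod (H2 (quotient_group N1)) ->
    torsion_free_zmod (H2 (quotient_group N2)) ->
  forall x n, (0 < n)%N -> x \in N1 -> x \in N2 ->
    x ^+ n \in commsub N1 N2 -> x \in commsub N1 N2.
Proof.
move=> projP N12 tf1 tf2 x n n0 x1 x2 xn.
have [xn1 xn2] := (commsub_sub1 xn, commsub_sub2 xn).
have xD : x \in commsub (full P) (full P).
  by apply: (projective_abelianization_tf projP n0); apply: commsub_sub1 xn1.
by apply: commsub_cap => //; [apply: hopf_torsion_free xn1
                             |apply: hopf_torsion_free xn2].
Qed.

(** * Passing from the free group to the subgroup [N1 N2] *)

Section Subgroup.
Variables (F : groupType) (N1 N2 : normalClosed F).
Local Notation P := (subgroup (prodset N1 N2)).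
Local Notation M1 := (in_subgroup (prodset N1 N2) N1).
Local Notation M2 := (in_subgroup (prodset N1 N2) N2).

Lemma prodset_l x : x \in N1 -> x \in prodset N1 N2.
Proof. by move=> xN; apply/asboolP; exists x, 1; rewrite gpred1 mulg1. Qed.
Lemma prodset_r x : x \in N2 -> x \in prodset N1 N2.
Proof. by move=> xN; apply/asboolP; exists 1, x; rewrite gpred1 mul1g. Qed.

Lemma in_subgroup_prodset (y : P) : y \in prodset M1 M2.
Proof.
have /asboolP[a [b [aN bN yE]]] := valP y.
apply/asboolP; exists (Subgroup (prodset_l aN)), (Subgroup (prodset_r bN)).
by split=> //; apply: val_inj; rewrite valM.
Qed.

Lemma commsub_in_subgroup (y : P) :
  (val y \in commsub N1 N2) = (y \in commsub M1 M2).
Proof.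
apply/idP/idP => yD.
  have sub : {subset commsub N1 N2 <= himage (val : P -> F) (commsub M1 M2)}.
    apply: commsub_min => a b aN bN; apply/asboolP.
    exists [~ Subgroup (prodset_l aN), Subgroup (prodset_r bN)].
      exact: commsub_gen.
    by rewrite gmulfR.
  by have /asboolP[z zD /val_inj ->] := sub _ yD.
suff /(_ y yD) : {subset commsub M1 M2 <=
    hpreim (val : P -> F) (commsub N1 N2)} by [].
apply: commsub_min => a b aN bN.
by rewrite unfold_in /hpreim gmulfR commsub_gen.
Qed.
End Subgroup.

Theorem theorem1 (F : groupType) (X : set F)
    (freeF : free_basis X) (nabF : ~ abelian_group F)
    (R1 R2 : set (word X)) (N1 N2 : normalClosed F)
    (defN1 : N1 =i nclosure [set word_eval w | w in R1])
    (defN2 : N2 =i nclosure [set word_eval w | w in R2])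
    (tfN1 : torsion_free (quotient_group (commsub (full F) N1)))
    (tfN2 : torsion_free (quotient_group (commsub (full F) N2)))
    (tfH1 : torsion_free_zmod
      (H2 (quotient_group (in_subgroup (prodset N1 N2) N1))))
    (tfH2 : torsion_free_zmod
      (H2 (quotient_group (in_subgroup (prodset N1 N2) N2)))) :
  torsion_free (quotient_group (commsub N1 N2)).
Proof.
apply/torsion_free_quotientP => x n n0 xn.
have x1 : x \in N1.
  move/torsion_free_quotientP: tfN1 => tf.
  exact/commsub_full_sub/(tf _ _ n0)/commsub_sub1/xn.
have x2 : x \in N2.
  move/torsion_free_quotientP: tfN2 => tf.
  exact/commsub_full_sub/(tf _ _ n0)/commsub_sub2/xn.
pose y : subgroup (prodset N1 N2) := Subgroup (prodset_l N2 x1).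
rewrite -[x]/(val y) commsub_in_subgroup.
apply: (projective_torsion _ _ tfH1 tfH2 n0) => //.
- exact: free_normal_projective freeF.
- exact: in_subgroup_prodset.
- by rewrite -commsub_in_subgroup gmulfXn.
Qed.
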